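(* Let $(M=G/H,\omega)$ be a homogeneous locally conformally symplectic manifold with Lee form $\lambda$ and $d\omega\neq0$, where $G$ is a connected Lie group acting effectively on $M$. Suppose $(M=G/H,\omega)$ is locally splittable, i.e. the ideal $\mathfrak g'=\ker\lambda\subset\mathfrak g$ has a complementary ideal: $\mathfrak g=\mathbb R D\oplus\mathfrak g'$ as a direct sum of ideals for some $D\in\mathfrak g$. Then $[\omega]=0$ in $H^2_\lambda(\mathfrak g,\mathfrak h)$, $H^1_\lambda(\mathfrak g,\mathfrak h)=0$, and the center $Z(\mathfrak g')$ of $\mathfrak g'$ satisfies $\dim Z(\mathfrak g')\le1$. In particular, these conclusions hold if $\mathfrak g$ is reductive.
   Context: A locally conformally symplectic manifold $(M,\omega)$ is a manifold with a non-degenerate $2$-form $\omega$ with $d\omega=\lambda\wedge\omega$ for a closed $1$-form $\lambda$ (Lee form). Homogeneous means that $G$ acts transitively preserving $\omega$, with closed stabilizer $H$; $\mathfrak g=\mathrm{Lie}\,G$, $\mathfrak h=\mathrm{Lie}\,H$. Invariant forms on $M$ (such as $\omega,\lambda$) are identified with $\mathrm{Ad}_H^*$-invariant forms on $\mathfrak g$ vanishing on $\mathfrak h$. Set $C^k(\mathfrak g,\mathfrak h)=\{\alpha\in(\wedge^k\mathfrak g^* )^H:\iota_X\alpha=0\ \forall X\in\mathfrak h\}$ (so $C^0=\mathbb R$) and $d_\lambda\alpha=d\alpha-\lambda\wedge\alpha$, with $d$ the Chevalley–Eilenberg differential; $H^k_\lambda(\mathfrak g,\mathfrak h)=\ker(d_\lambda:C^k\to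 C^{k+1})/\mathrm{im}(d_\lambda:C^{k-1}\to C^k)$, and $[\omega]$ is the class of $\omega$ in $H^2_\lambda(\mathfrak g,\mathfrak h)$. *)

(* Defs.v *)
From HB Require Import structures.
From mathcomp Require Import all_boot all_order all_algebra.
From mathcomp Require Import all_classical all_reals all_analysis.

Set Implicit Arguments.
Unset Strict Implicit.
Unset Printing Implicit Defensive.

Import Order.TTheory GRing.Theory Num.Theory.
Import numFieldNormedType.Exports.

Local Open Scope classical_set_scope.
Local Open Scope ring_scope.

(* f is of class C^k at every point of the (open) set A: iterated Frechet
   differentials, evaluated on vectors, exist and are continuous. *)
Fixpoint class_C (R : realType) (V W : normedModType R) (k : nat)
    (A : set V) (f : V -> W) : Prop :=
  match k with
  | 0 => forall x, A x -> {for x, continuous f}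
  | k'.+1 => (forall x, A x -> differentiable f x) /\
             (forall v, class_C k' A (fun x => 'd f x v))
  end.

Definition smooth_on (R : realType) (V W : normedModType R)
    (A : set V) (f : V -> W) : Prop :=
  forall k, class_C k A f.

(* A homeomorphism from an open subset of T onto an open subset of R^n; the
   values of the two functions outside of these sets are irrelevant. *)
Record chart (R : realType) (n : nat) (T : topologicalType) := Chart {
  chart_dom : set T;
  chart_fun :> T -> 'rV[R]_n;
  chart_inv : 'rV[R]_n -> T;
  chart_dom_open : open chart_dom;
  chart_img_open : open (chart_fun @` chart_dom);
  chart_funK : {in chart_dom, cancel chart_fun chart_inv};
  chart_fun_continuous : {within chart_dom, continuous chart_fun};
  chart_inv_continuous :
    {within chart_fun @` chart_dom, continuous chart_inv}
}.

Definition chart_img (R : realType) (n : nat) (T : topologicalType)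
    (c : chart R n T) : set 'rV[R]_n :=
  c @` chart_dom c.

Record smooth_atlas (R : realType) (n : nat) (T : topologicalType) :=
  SmoothAtlas {
  atlas_index : Type;
  atlas_chart :> atlas_index -> chart R n T;
  atlas_cover : forall x : T, exists i, chart_dom (atlas_chart i) x;
  atlas_compat : forall i j,
    smooth_on (atlas_chart i @`
                 (chart_dom (atlas_chart i) `&` chart_dom (atlas_chart j)))
              (atlas_chart j \o chart_inv (atlas_chart i))
}.

(* Bare join, without compatibility between the group law and the topology. *)
#[short(type="preTopGroupType")]
HB.structure Definition PreTopGroup := {G of Group G & Topological G}.

Record lieGroup (R : realType) (n : nat) := LieGroup {
  lg_sort :> preTopGroupType;
  lg_atlas : smooth_atlas R n lg_sort;
  lg_hausdorff : hausdorff_space lg_sort;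
  lg_second_countable : @second_countable lg_sort;
  lg_mul_continuous : continuous (fun p : lg_sort * lg_sort => (p.1 * p.2)%g);
  lg_inv_continuous : continuous (fun x : lg_sort => (x^-1)%g);
  lg_mul_smooth : forall i j k : atlas_index lg_atlas,
    let m (u : 'rV[R]_n * 'rV[R]_n) :=
      (chart_inv (lg_atlas i) u.1 * chart_inv (lg_atlas j) u.2)%g in
    smooth_on [set u | [/\ chart_img (lg_atlas i) u.1,
                           chart_img (lg_atlas j) u.2 &
                           chart_dom (lg_atlas k) (m u)]]
              (lg_atlas k \o m);
  lg_inv_smooth : forall i j : atlas_index lg_atlas,
    let s (u : 'rV[R]_n) := ((chart_inv (lg_atlas i) u)^-1)%g in
    smooth_on [set u | chart_img (lg_atlas i) u /\
                       chart_dom (lg_atlas j) (s u)]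
              (lg_atlas j \o s)
}.

Section LieAlgebra.
Context {R : realType} {n : nat} (G : lieGroup R n).

(* A chart around the unit, chosen once and for all; it identifies the tangent
   space of G at 1, i.e. the Lie algebra, with 'rV[R]_n. *)
Definition unit_chart : chart R n G :=
  lg_atlas G (sval (cid (atlas_cover (lg_atlas G) 1%g))).

Local Notation phi := unit_chart.
Local Notation psi := (chart_inv unit_chart).
Local Notation g := 'rV[R]_n.

(* The left-invariant vector field with value v at 1, read in the chart: its
   value at the point p = psi x is the differential at 1 of the left
   translation by p, applied to v. *)
Definition left_inv_field (v : g) : g -> g :=
  fun x => 'd (fun y => phi (psi x * psi y)%g) (phi 1%g) v.

(* Commutator of vector fields on an open subset of R^n. *)
Definition field_bracket (X Y : g -> g) : g -> g :=
  fun x => 'd Y x (X x) - 'd X x (Y x).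

Definition lie_bracket (u v : g) : g :=
  field_bracket (left_inv_field u) (left_inv_field v) (phi 1%g).

Definition Ad (a : G) (v : g) : g :=
  'd (fun x => phi (a * psi x * a^-1)%g) (phi 1%g) v.

Definition closed_subgroup (H : set G) : Prop :=
  [/\ H 1%g, forall x y, H x -> H y -> H (x * y)%g,
      forall x, H x -> H (x^-1)%g & closed H].

(* a x H = x H for all x implies a = 1. *)
Definition effective_on_cosets (H : set G) : Prop :=
  forall a : G, (forall x : G, H (x^-1 * (a * x))%g) -> a = 1%g.

(* Lie H = {v | exp(t v) \in H for all t}, exp(t v) being the one-parameter
   subgroup with velocity v at t = 0. *)
Definition lie_subgroup (H : set G) (v : g) : Prop :=
  exists gamma : R -> G,
    [/\ continuous gamma,
        forall s t, gamma (s + t) = (gamma s * gamma t)%g,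
        is_derive (0 : R) (1 : R) (phi \o gamma) v &
        forall t, H (gamma t)].

Definition replace_at (k : nat) (X : 'I_k -> g) (i : 'I_k) (v : g) : 'I_k -> g :=
  fun j => if j == i then v else X j.

Definition multilinear (k : nat) (a : ('I_k -> g) -> R) : Prop :=
  forall (X : 'I_k -> g) (i : 'I_k) (c : R) (u v : g),
    a (replace_at X i (c *: u + v)) =
    c * a (replace_at X i u) + a (replace_at X i v).

Definition alternating (k : nat) (a : ('I_k -> g) -> R) : Prop :=
  forall (X : 'I_k -> g) (i j : 'I_k), i != j -> X i = X j -> a X = 0.

(* The space C^k(g, h); since 'I_0 -> g has a single element, C^0 is R. *)
Definition rel_cochain (H : set G) (k : nat) (a : ('I_k -> g) -> R) : Prop :=
  [/\ multilinear a, alternating a,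
      forall b, H b -> forall X, a (Ad b \o X) = a X &
      forall X i, lie_subgroup H (X i) -> a X = 0].

Definition cons_vect (k : nat) (v : g) (X : 'I_k -> g) : 'I_k.+1 -> g :=
  fun l => oapp X v (unlift ord0 l).

(* (d a)(X_0, .., X_k) = \sum_(i < j) (-1)^(i+j) a([X_i, X_j], X_0, .., X_k)
   with X_i and X_j omitted on the right. Here the second index of the bracket
   is lift i j = j + 1, for i <= j. *)
Definition ce_diff (k : nat) : (('I_k -> g) -> R) -> ('I_k.+1 -> g) -> R :=
  match k with
  | 0 => fun _ _ => 0
  | m.+1 => fun a X =>
      \sum_(i < m.+2) \sum_(j < m.+1 | (i <= j)%N)
        (-1) ^+ (i + j.+1) *
        a (cons_vect (lie_bracket (X i) (X (lift i j)))
                     (fun l : 'I_m => X (lift i (lift j l))))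
  end.

Definition form1 (lambda : ('I_1 -> g) -> R) (v : g) : R :=
  lambda (fun=> v).

Definition wedge1 (lambda : ('I_1 -> g) -> R) (k : nat)
    (a : ('I_k -> g) -> R) : ('I_k.+1 -> g) -> R :=
  fun X => \sum_(i < k.+1)
    (-1) ^+ i * form1 lambda (X i) * a (fun j => X (lift i j)).

Definition twisted_diff (lambda : ('I_1 -> g) -> R) (k : nat)
    (a : ('I_k -> g) -> R) : ('I_k.+1 -> g) -> R :=
  fun X => ce_diff a X - wedge1 lambda a X.

Definition cocycle (H : set G) (lambda : ('I_1 -> g) -> R) (k : nat)
    (a : ('I_k -> g) -> R) : Prop :=
  rel_cochain H a /\ twisted_diff lambda a = (fun=> 0).

Definition coboundary (H : set G) (lambda : ('I_1 -> g) -> R) (k : nat)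
    (a : ('I_k.+1 -> g) -> R) : Prop :=
  exists2 b : ('I_k -> g) -> R, rel_cochain H b & a = twisted_diff lambda b.

(* [a] = 0 in H^(k+1)_lambda(g, h). *)
Definition trivial_class (H : set G) (lambda : ('I_1 -> g) -> R) (k : nat)
    (a : ('I_k.+1 -> g) -> R) : Prop :=
  cocycle H lambda a /\ coboundary H lambda a.

(* H^(k+1)_lambda(g, h) = 0. *)
Definition cohomology_vanishes (H : set G) (lambda : ('I_1 -> g) -> R)
    (k : nat) : Prop :=
  forall a : ('I_k.+1 -> g) -> R, cocycle H lambda a -> coboundary H lambda a.

(* An invariant 2-form on G/H is nondegenerate iff the kernel of the
   corresponding form on g, which contains h, is equal to h. *)
Definition nondegenerate_mod (H : set G) (omega : ('I_2 -> g) -> R) : Prop :=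
  forall u : g, (forall v, omega (cons_vect u (fun=> v)) = 0) ->
    lie_subgroup H u.

(* G-invariant locally conformally symplectic structure on G/H with Lee form
   lambda. *)
Definition homogeneous_lcs (H : set G) (omega : ('I_2 -> g) -> R)
    (lambda : ('I_1 -> g) -> R) : Prop :=
  [/\ rel_cochain H omega, nondegenerate_mod H omega,
      rel_cochain H lambda, ce_diff lambda = (fun=> 0) &
      ce_diff omega = wedge1 lambda omega].

Definition lie_ideal (I : {vspace g}) : Prop :=
  forall u v, v \in I -> lie_bracket u v \in I.

(* linfun f is equal to f as soon as f is linear. *)
Definition ker_form (lambda : ('I_1 -> g) -> R) : {vspace g} :=
  lker (linfun (form1 lambda : g -> R^o)).

Definition locally_splittable (lambda : ('I_1 -> g) -> R) : Prop :=
  exists D : g,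
    [/\ lie_ideal <[D]>, lie_ideal (ker_form lambda),
        (<[D]> + ker_form lambda = fullv)%VS &
        directv (<[D]> + ker_form lambda)].

Definition center_of (U : {vspace g}) (u : g) : Prop :=
  u \in U /\ (forall v, v \in U -> lie_bracket u v = 0).

Definition abelian_ideal (I : {vspace g}) : Prop :=
  lie_ideal I /\ (forall u v, u \in I -> v \in I -> lie_bracket u v = 0).

(* An ideal of g which is simple as a Lie algebra. *)
Definition simple_ideal (S : {vspace g}) : Prop :=
  [/\ lie_ideal S,
      exists u v, [/\ u \in S, v \in S & lie_bracket u v <> 0] &
      forall J : {vspace g}, (J <= S)%VS ->
        (forall u v, u \in S -> v \in J -> lie_bracket u v \in J) ->
        J = 0%VS \/ J = S].

(* g is the direct sum of an abelian ideal and a semisimple ideal, the latter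
   being a finite direct sum of simple ideals. *)
Definition reductive : Prop :=
  exists (A : {vspace g}) (k : nat) (S : 'I_k -> {vspace g}),
    [/\ abelian_ideal A, forall i, simple_ideal (S i),
        (A + \sum_(i < k) S i = fullv)%VS &
        directv (A + \sum_(i < k) S i)].

End LieAlgebra.

(* Main.v *)
Require Import Defs.
From HB Require Import structures.
From mathcomp Require Import all_boot all_order all_algebra.
From mathcomp Require Import all_classical all_reals all_analysis.
From mathcomp Require Import ring lra.

Import Order.TTheory GRing.Theory Num.Theory.
Import numFieldNormedType.Exports.

Local Open Scope classical_set_scope.
Local Open Scope ring_scope.

(** In both cases of the theorem [g] contains a central vector [D] on which the
    Lee form does not vanish. In the splittable case, the Lee form [lambda] is
    closed, hence vanishes on brackets, so that the ideal [<[D]>] can only be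
    central ([splittable_central]); in the reductive case the simple ideals lie
    in the kernel of [lambda], so that some vector of the abelian factor lies
    outside of this kernel ([reductive_central]).

    Given such a [D], contract [d omega = lambda /\ omega] with it. The terms
    with [[D, u]] vanish, which leaves
    [lambda(D) omega(u, v) = eta([u, v]) + lambda(u) eta(v) - lambda(v) eta(u)]
    where [eta = omega(D, _)] ([lcs_form_central]): so [omega] is the twisted
    differential of [- eta / lambda(D)]. In the same way, contracting with [D]
    shows that a twisted 1-cocycle [a] is the twisted differential of the
    constant [- a(D) / lambda(D)]. Finally let [u] be in the center of
    [ker lambda], hence of [g]. The formula reads
    [lambda(D) omega(v, u) = lambda(v) eta(u)], so that [eta(u) = 0] puts [u] in
    the kernel of [omega], which is the Lie algebra of [H]; the corresponding
    one-parameter subgroup of [H] is central in [G], hence trivial as the action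
    is effective, and [u = 0]. Therefore [eta] is injective on this center, whose
    dimension is at most 1.

    Two facts of Lie theory enter. First, [eta] is invariant under [H], which
    need not be connected, because a central [D] is fixed by [Ad a] for all [a]
    in the connected group [G] ([Ad_central]). Second, the one-parameter subgroup
    with central velocity [u] commutes with [G] ([one_parameter_commute]). For the
    first one, write [L_v] and [R_v] for the left- and right-invariant fields in
    the chart at the unit, so that [L_D(x) = R_(Ad x D)(x)]. The differential of
    [L_D - R_D] at the unit is [u |-> [u, D]]: this is Schwarz's theorem for the
    multiplication. It vanishes, hence so does that of [x |-> Ad x D]; by the
    multiplicativity of [Ad] the latter function has zero differential near the
    unit, is constant there, and then is constant on the connected group [G].
    For the second one, [x gamma(t) x^-1 gamma(t)^-1] is likewise shown to have
    zero velocity, which replaces the uniqueness of integral curves. *)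

Set Implicit Arguments.
Unset Strict Implicit.
Unset Printing Implicit Defensive.

(** * Differentials and germs *)

Section DiffEps.
Context {R : realType} {V W : normedModType R}.

Lemma diff_eps (f : V -> W) x : differentiable f x ->
  forall e, 0 < e ->
  \forall h \near 0, `|f (h + x) - f x - 'd f x h| <= e * `|h|.
Proof.
move=> /diff_locallyP[_ /eqaddoP fo] e e0.
have := fo e e0; apply: filterS => h /=.
by rewrite !fctE opprD addrA.
Qed.

Lemma is_diff_eps (f : V -> W) (L : {linear V -> W}) x : continuous L ->
  (forall e, 0 < e ->
    \forall h \near 0, `|f (h + x) - f x - L h| <= e * `|h|) ->
  is_diff x f L.
Proof.
move=> cL fe.
have fo : f \o shift x = cst (f x) + L +o_ 0 id.
  apply/eqaddoP => e e0.
  by have := fe e e0; apply: filterS => h /=; rewrite !fctE opprD addrA.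
have dE := diff_unique cL fo.
by apply: DiffDef => //; apply/diff_locallyP; rewrite dE.
Qed.

(** Being differentiable at a point, and the differential there, only depend
    on the germ of the function. *)
Lemma near_eq_is_diff (f g : V -> W) x :
  (\forall y \near x, f y = g y) -> differentiable f x ->
  is_diff x g ('d f x).
Proof.
move=> fg df; apply: is_diff_eps => [|e e0]; first exact: diff_continuous.
have fg0 : \forall h \near 0, f (h + x) = g (h + x).
  by move: fg; rewrite (near_shift 0) subr0.
near=> h.
rewrite -(nbhs_singleton fg); have <- : f (h + x) = g (h + x) by near: h.
by near: h; exact: diff_eps.
Unshelve. all: by end_near. Qed.

Lemma near_eq_differentiable (f g : V -> W) x :
  (\forall y \near x, f y = g y) -> differentiable f x -> differentiable g x.
Proof. by move=> fg /(near_eq_is_diff fg)[]. Qed.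

Lemma near_eq_diff (f g : V -> W) x :
  (\forall y \near x, f y = g y) -> differentiable f x ->
  'd f x = 'd g x :> (V -> W).
Proof. by move=> fg /(near_eq_is_diff fg)[]. Qed.

End DiffEps.

(** * The mean value inequality and Schwarz's theorem *)

(** The mean value inequality follows coordinatewise from the mean value
    theorem, as the norm of row vectors is the maximum of the coordinates. *)
Lemma mean_value_ineq (R : realType) n (f f' : R -> 'rV[R]_n) c (t K : R) :
  0 <= t -> 0 <= K ->
  (forall s, s \in `[0, t] -> is_derive s 1 f (f' s)) ->
  (forall s, s \in `[0, t] -> `|f' s - c| <= K) ->
  `|f t - f 0 - t *: c| <= K * t.
Proof.
move=> t0 K0 df bf; rewrite /Num.Def.normr/= mx_normrE.
apply: bigmax_le => [|[i j] _ /=]; first by rewrite mulr_ge0.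
pose h s := f s i j - s * c i j.
have dh s : s \in `[0, t] -> is_derive s 1 h (f' s i j - c i j).
  move=> /df [dfs <-]; have -> : h = (fun s => f s i j) - (fun s => s * c i j).
    by [].
  rewrite derive_mx// mxE; apply: is_deriveB.
    by apply: derivableP; move/derivable_mxP : dfs; exact.
  have -> : (fun s => s * c i j) = *:%R (c i j).
    by apply/funext => y; rewrite /GRing.scale/= mulrC.
  rewrite -[X in is_derive _ _ _ X]mulr1; exact: is_deriveZ.
have dho s : s \in `]0, t[ -> is_derive s 1 h (f' s i j - c i j).
  by rewrite in_itv/= => /andP[s0 st]; apply: dh; rewrite in_itv/= !ltW.
have ch : {within `[0, t], continuous h}.
  by apply: derivable_within_continuous => s /dh [].
have [s ss] := MVT_segment t0 dho ch.
rewrite /h mul0r subr0 subr0 => E.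
have -> : (f t - f 0 - t *: c) i j = (f' s - c) i j * t.
  by rewrite !mxE -E addrAC.
rewrite normrM (ger0_norm t0) ler_wpM2r//.
apply: le_trans (bf s ss).
rewrite [leRHS]/Num.Def.normr/= mx_normrE.
exact: (le_bigmax _ (fun k : 'I_1 * 'I_n => `|(f' s - c) k.1 k.2|) (i, j)).
Qed.

Section Schwarz.
Context {R : realType} {V : normedModType R} {n : nat}.
Implicit Types (f : V -> 'rV[R]_n) (u v : V).

Lemma is_derive_line f (x u : V) (s : R) : differentiable f (x + s *: u) ->
  is_derive s 1 (fun s => f (x + s *: u)) ('d f (x + s *: u) u).
Proof.
move=> df.
have dl : is_diff s (cst x + *:%R ^~ u) (0 + *:%R ^~ u).
  exact: is_diffD.
have dc : is_diff s (f \o (cst x + *:%R ^~ u)) ('d f (x + s *: u) \o (0 + *:%R ^~ u)).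
  exact: (@is_diff_comp _ _ _ _ _ _ _ _ _ dl (differentiableP df)).
have -> : (fun s : R => f (x + s *: u)) = f \o (cst x + *:%R ^~ u) by [].
have d1 : derivable (f \o (cst x + *:%R ^~ u)) s 1.
  exact/derivable1_diffP.
 apply: DeriveDef => //; rewrite deriveE// diff_val/=.
by rewrite !fctE add0r scale1r.
Qed.

(** The mean value inequality applied to
    [s |-> f (x + s *: u + t *: v) - f (x + s *: u)] on [[0, t]]: its derivative
    is a difference of two values of [y |-> 'd f y u], which is [t] times the
    second derivative along [v], up to [o(t)]. *)
Lemma second_difference f x u v :
  (\forall y \near x, differentiable f y) ->
  differentiable (fun y => 'd f y u) x ->
  forall e, 0 < e -> \forall t \near 0^'+,
    `|f (x + t *: u + t *: v) - f (x + t *: u) - (f (x + t *: v) - f x)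
       - (t * t) *: 'd (fun y => 'd f y u) x v| <= e * (t * t).
Proof.
move=> df dA e e0; set A := fun y => 'd f y u.
(* [N] bounds the norm of all the increments below, divided by [t]. *)
pose N := `|u| + (`|u| + `|v|) + 1.
have N0 : 0 < N by rewrite ltr_wpDl// !addr_ge0.
pose e' := e / N; have e'0 : 0 < e' by rewrite divr_gt0.
have := diff_eps dA e'0.
have : \forall h \near 0, differentiable f (h + x).
  by move: df; rewrite (near_shift 0) subr0.
move=> /nbhs_ballP[d1 /= d10 B1] /nbhs_ballP[d2 /= d20 B2].
near=> t.
have t0 : 0 < t by [].
have small (h : V) : `|h| <= t * N -> ball 0 d1 h /\ ball 0 d2 h.
  move=> hN; rewrite -!ball_normE /= !sub0r !normrN.
  split; apply: (le_lt_trans hN); rewrite -ltr_pdivlMr//.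
    by near: t; apply: nbhs_right_lt; rewrite divr_gt0.
  by near: t; apply: nbhs_right_lt; rewrite divr_gt0.
have nrm s : s \in `[0, t] ->
    `|s *: u| <= t * `|u| /\ `|s *: u + t *: v| <= t * (`|u| + `|v|).
  rewrite in_itv/= => /andP[s0 st].
  have su : `|s *: u| <= t * `|u|.
    by rewrite normrZ ger0_norm// ler_wpM2r.
  split=> //; rewrite (le_trans (ler_normD _ _))// mulrDr lerD//.
  by rewrite normrZ gtr0_norm.
have uN : `|u| <= N by rewrite /N -addrA lerDl !addr_ge0.
have uvN : `|u| + `|v| <= N by rewrite /N addrAC lerDr addr_ge0.
have nrm1 s : s \in `[0, t] ->
    `|s *: u| <= t * N /\ `|s *: u + t *: v| <= t * N.
  move=> /nrm[h1 h2]; split.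
    by rewrite (le_trans h1)// ler_wpM2l// ltW.
  by rewrite (le_trans h2)// ler_wpM2l// ltW.
pose g s := f ((x + t *: v) + s *: u) - f (x + s *: u).
pose g' s := A ((x + t *: v) + s *: u) - A (x + s *: u).
have K0 : 0 <= e * t by rewrite mulr_ge0 ?ltW.
have dg s : s \in `[0, t] -> is_derive s 1 g (g' s).
  move=> /nrm1[/small[s1 _] /small[s2 _]].
  apply: is_deriveB; apply: is_derive_line.
    by rewrite -addrA addrC [t *: v + _]addrC; exact: B1.
  by rewrite addrC; exact: B1.
have bg s : s \in `[0, t] -> `|g' s - t *: 'd A x v| <= e * t.
  move=> st; have [s1 s2] := nrm1 _ st.
  have [_ b1] := small _ s1; have [_ b2] := small _ s2.
  have {}b1 := B2 _ b1; have {}b2 := B2 _ b2.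
  have [n1 n2] := nrm _ st.
  have -> : g' s - t *: 'd A x v =
    (A (s *: u + t *: v + x) - A x - 'd A x (s *: u + t *: v)) -
    (A (s *: u + x) - A x - 'd A x (s *: u)).
    rewrite /g' linearD [t *: 'd A x v](_ : _ = 'd A x (t *: v)) ?linearZ//.
    rewrite [x + s *: u]addrC -[x + t *: v + s *: u]addrA.
    rewrite [x + (_ + _)]addrC [t *: v + _]addrC.
    move: (A (s *: u + t *: v + x)) (A (s *: u + x)) (A x)
      ('d A x (s *: u)) ('d A x (t *: v)) => a b c p q.
    by apply/rowP => k; rewrite !mxE; ring.
  rewrite (le_trans (ler_normB _ _))//.
  apply: (le_trans (lerD b2 b1)); rewrite -mulrDr.
  have -> : e * t = e' * (t * N) by rewrite /e' mulrA mulrAC divfK// gt_eqF.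
  rewrite ler_wpM2l ?(ltW e'0)//; apply: (le_trans (lerD n2 n1)).
  by rewrite -mulrDr ler_wpM2l ?(ltW t0)// /N [`|u| + (_ + _)]addrC lerDl.
have := mean_value_ineq (ltW t0) K0 dg bg.
rewrite /g !scale0r !addr0 scalerA -mulrA.
by rewrite [x + t *: v + _]addrAC.
Unshelve. all: by end_near. Qed.


(** Young's form of Schwarz's theorem. Divided by [t ^+ 2], the symmetric
    second difference of [f] along [u] and [v] tends to both members. *)
Lemma schwarz f x u v :
  (\forall y \near x, differentiable f y) ->
  differentiable (fun y => 'd f y u) x ->
  differentiable (fun y => 'd f y v) x ->
  'd (fun y => 'd f y u) x v = 'd (fun y => 'd f y v) x u.
Proof.
move=> df du dv; apply/subr0_eq/normr0_eq0/eqP.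
rewrite eq_le normr_ge0 andbT; apply/ler_addgt0Pr => e e0; rewrite add0r.
have e20 : 0 < e / 2 by rewrite divr_gt0.
have [t [t0 h1 h2]] : exists t : R, [/\ 0 < t,
    `|f (x + t *: u + t *: v) - f (x + t *: u) - (f (x + t *: v) - f x)
       - (t * t) *: 'd (fun y => 'd f y u) x v| <= e / 2 * (t * t) &
    `|f (x + t *: v + t *: u) - f (x + t *: v) - (f (x + t *: u) - f x)
       - (t * t) *: 'd (fun y => 'd f y v) x u| <= e / 2 * (t * t)].
  apply: (@filter_ex _ 0^'+); near=> t; split=> //.
    by near: t; exact: second_difference.
  by near: t; exact: second_difference.
have tt0 : 0 < t * t by rewrite mulr_gt0.
rewrite -(ler_pM2l tt0) -{1}(gtr0_norm tt0) -normrZ.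
rewrite [t * t * e](_ : _ = e / 2 * (t * t) + e / 2 * (t * t)); last first.
  by rewrite -mulrDl -splitr mulrC.
apply: le_trans (lerD h2 h1); apply: le_trans (ler_normB _ _).
rewrite le_eqVlt; apply/orP; left; apply/eqP; congr `|_|.
rewrite [x + t *: v + t *: u]addrAC.
by apply/rowP => k; rewrite !mxE; ring.
Unshelve. all: by end_near. Qed.

End Schwarz.

Section ZeroDifferential.
Context {R : realType} {V : normedModType R} {n : nat}.

Lemma diff0_ball_cst (f : V -> 'rV[R]_n) x r :
  (forall y, ball x r y -> is_diff y f 0) ->
  forall y, ball x r y -> f y = f x.
Proof.
move=> df y xry.
have d (s : R) : s \in `[0, 1] ->
    is_derive s 1 (fun s : R => f (x + s *: (y - x))) 0.
  rewrite in_itv/= => /andP[s0 s1].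
  have b : ball x r (x + s *: (y - x)).
    move: xry; rewrite -!ball_normE/= opprD addNKr normrN.
    rewrite -normrN opprB => h; apply: le_lt_trans h.
    by rewrite normrZ ger0_norm// ler_piMl.
  have [dfs E] := df _ b.
  by have := is_derive_line dfs; rewrite E.
have b0 (s : R) : s \in `[0, 1] -> `|0 - 0 : 'rV[R]_n| <= 0.
  by rewrite subrr normr0.
have := mean_value_ineq ler01 (lexx 0) d b0.
rewrite scale0r addr0 scale1r scaler0 subr0 mul0r normr_le0 subr_eq0 addrC.
by rewrite subrK => /eqP.
Qed.

End ZeroDifferential.

Section PartialMaps.
Context {R : realType} {V W : normedModType R}.

Lemma is_diff_pairl (x : V) (y : W) :
  is_diff x (fun z => (z, y)) (fun z => (z, 0)).
Proof. exact: is_diff_pair (is_diff_id x) (is_diff_cst y x). Qed.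

Lemma is_diff_pairr (x : V) (y : W) :
  is_diff x (fun z => (y, z)) (fun z => (0, z)).
Proof. exact: is_diff_pair (is_diff_cst y x) (is_diff_id x). Qed.

End PartialMaps.

(** * Charts and translations of a Lie group *)

Section Charts.
Context {R : realType} {n : nat} {T : topologicalType} (c : chart R n T).

Lemma chartK x : chart_dom c x -> chart_inv c (c x) = x.
Proof. by move=> cx; rewrite (chart_funK (c := c))// inE. Qed.

Lemma chart_img_fun x : chart_dom c x -> chart_img c (c x).
Proof. by move=> cx; exists x. Qed.

Lemma chart_invK y : chart_img c y -> c (chart_inv c y) = y.
Proof. by move=> [x cx <-]; rewrite chartK. Qed.

Lemma chart_dom_inv y : chart_img c y -> chart_dom c (chart_inv c y).
Proof. by move=> [x cx <-]; rewrite chartK. Qed.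

Lemma near_chart_dom x : chart_dom c x -> \forall y \near x, chart_dom c y.
Proof. by move=> cx; apply: open_nbhs_nbhs; split=> //; exact: chart_dom_open. Qed.

Lemma near_chart_img y : chart_img c y -> \forall z \near y, chart_img c z.
Proof. by move=> cx; apply: open_nbhs_nbhs; split=> //; exact: chart_img_open. Qed.

Lemma chart_continuous_at x : chart_dom c x -> {for x, continuous c}.
Proof.
move=> cx; have := chart_fun_continuous (c := c).
rewrite continuous_open_subspace; last exact: chart_dom_open.
by apply; rewrite inE.
Qed.

Lemma chart_inv_continuous_at y :
  chart_img c y -> {for y, continuous (chart_inv c)}.
Proof.
move=> cx; have := chart_inv_continuous (c := c).
rewrite continuous_open_subspace; last exact: chart_img_open.
by apply; rewrite inE.
Qed.

End Charts.

Lemma near_continuous (T U : topologicalType) (f : T -> U) x (P : U -> Prop) :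
  {for x, continuous f} -> (\forall y \near f x, P y) ->
  \forall z \near x, P (f z).
Proof. by move=> cf; exact: cf. Qed.

Section LieGroup.
Context {R : realType} {n : nat} {G : lieGroup R n}.

Lemma continuous_mul2 (T : topologicalType) (f g : T -> G) x :
  {for x, continuous f} -> {for x, continuous g} ->
  {for x, continuous (fun y => (f y * g y)%g)}.
Proof.
move=> cf cg.
have cp : (f y, g y) @[y --> x] --> nbhs (f x, g x).
  exact: (cvg_pair cf cg).
have cm := @lg_mul_continuous _ _ G (f x, g x).
exact: (@cvg_comp _ _ _ _ (fun p : G * G => (p.1 * p.2)%g) _ _ _ cp cm).
Qed.

Lemma continuous_lmul (a : G) : continuous (fun x : G => (a * x)%g).
Proof. by move=> x; apply: continuous_mul2 => //; exact: cvg_cst. Qed.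

Lemma diff_lmul (i k : atlas_index (lg_atlas G)) (a : G) x :
  chart_img (lg_atlas G i) x ->
  chart_dom (lg_atlas G k) (a * chart_inv (lg_atlas G i) x)%g ->
  differentiable
    (fun y => lg_atlas G k (a * chart_inv (lg_atlas G i) y)%g) x.
Proof.
move=> ix kx; have [j ja] := atlas_cover (lg_atlas G) a.
have [/(_ (lg_atlas G j a, x)) dm _] := lg_mul_smooth j i k 1.
have {}dm : differentiable (lg_atlas G k \o
    (fun u => chart_inv (lg_atlas G j) u.1 * chart_inv (lg_atlas G i) u.2)%g)
    (lg_atlas G j a, x).
  by apply: dm; split=> /=; rewrite ?chartK//; exact: chart_img_fun.
have dp : differentiable (fun y => (lg_atlas G j a, y)) x.
  by apply: differentiable_pair => //; exact: differentiable_cst.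
have := differentiable_comp dp dm.
by rewrite /comp/=; under eq_fun do rewrite chartK//.
Qed.

Lemma diff_rmul (i k : atlas_index (lg_atlas G)) (a : G) x :
  chart_img (lg_atlas G i) x ->
  chart_dom (lg_atlas G k) (chart_inv (lg_atlas G i) x * a)%g ->
  differentiable
    (fun y => lg_atlas G k (chart_inv (lg_atlas G i) y * a)%g) x.
Proof.
move=> ix kx; have [j ja] := atlas_cover (lg_atlas G) a.
have [/(_ (x, lg_atlas G j a)) dm _] := lg_mul_smooth i j k 1.
have {}dm : differentiable (lg_atlas G k \o
    (fun u => chart_inv (lg_atlas G i) u.1 * chart_inv (lg_atlas G j) u.2)%g)
    (x, lg_atlas G j a).
  by apply: dm; split=> /=; rewrite ?chartK//; exact: chart_img_fun.
have dp : differentiable (fun y => (y, lg_atlas G j a)) x.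
  by apply: differentiable_pair => //; exact: differentiable_cst.
have := differentiable_comp dp dm.
by rewrite /comp/=; under eq_fun do rewrite chartK//.
Qed.

(** The two translations are composed through a chart at the intermediate
    point. *)
Lemma diff_conj (i k : atlas_index (lg_atlas G)) (a b : G) x :
  chart_img (lg_atlas G i) x ->
  chart_dom (lg_atlas G k) (a * chart_inv (lg_atlas G i) x * b)%g ->
  differentiable
    (fun y => lg_atlas G k (a * chart_inv (lg_atlas G i) y * b)%g) x.
Proof.
move=> ix kx.
have [j ja] := atlas_cover (lg_atlas G) (a * chart_inv (lg_atlas G i) x)%g.
have dl := diff_lmul ix ja.
have dr : differentiable
    (fun y => lg_atlas G k (chart_inv (lg_atlas G j) y * b)%g)
    (lg_atlas G j (a * chart_inv (lg_atlas G i) x)%g).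
  by apply: diff_rmul; rewrite ?chartK//; exact: chart_img_fun.
apply: near_eq_differentiable (differentiable_comp dl dr).
have cl : {for x, continuous (fun y => a * chart_inv (lg_atlas G i) y)%g}.
  apply: (@continuous_mul2 _ (cst a) (chart_inv (lg_atlas G i))).
    exact: cst_continuous.
  exact: chart_inv_continuous_at.
have nj : \forall y \near x,
    chart_dom (lg_atlas G j) (a * chart_inv (lg_atlas G i) y)%g.
  exact: cl _ (near_chart_dom ja).
by apply: filterS nj => y jy /=; rewrite chartK.
Qed.

End LieGroup.

(** * Invariant fields and the bracket *)

Section Bracket.
Context {R : realType} {n : nat} {G : lieGroup R n}.

Local Notation phi := (unit_chart G).
Local Notation psi := (chart_inv (unit_chart G)).
Local Notation e := (phi 1%g).
Local Notation g := 'rV[R]_n.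

Lemma unit_chart_dom1 : chart_dom phi 1%g.
Proof. exact: (svalP (cid (atlas_cover (lg_atlas G) 1%g))). Qed.

Lemma unit_chart_img1 : chart_img phi e.
Proof. exact: chart_img_fun unit_chart_dom1. Qed.

Lemma unit_chart_inv1 : psi e = 1%g.
Proof. exact: chartK unit_chart_dom1. Qed.

Definition chart_mul (u : g * g) : g := phi (psi u.1 * psi u.2)%g.

Definition right_inv_field (w : g) : g -> g :=
  fun x => 'd (fun y => phi (psi y * psi x)%g) e w.

Lemma near_chart_mul_dom : \forall p \near (e, e),
  [/\ chart_img phi p.1, chart_img phi p.2 &
      chart_dom phi (psi p.1 * psi p.2)%g].
Proof.
have cpsi := chart_inv_continuous_at unit_chart_img1.
have c1 : {for (e, e), continuous (psi \o fst : g * g -> G)}.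
  apply: continuous_comp; [exact: cvg_fst|exact: cpsi].
have c2 : {for (e, e), continuous (psi \o snd : g * g -> G)}.
  apply: continuous_comp; [exact: cvg_snd|exact: cpsi].
have cm := continuous_mul2 c1 c2.
have dm : nbhs (psi e * psi e)%g (chart_dom phi).
  by apply: near_chart_dom; rewrite unit_chart_inv1 mulg1; exact: unit_chart_dom1.
have h3 : \forall p \near (e, e), chart_dom phi (psi p.1 * psi p.2)%g.
  exact: cm _ dm.
have h1 : \forall p \near (e, e), chart_img phi p.1.
  exact: (@cvg_fst _ _ (nbhs e) (nbhs e) _ _ (near_chart_img unit_chart_img1)).
have h2 : \forall p \near (e, e), chart_img phi p.2.
  exact: (@cvg_snd _ _ (nbhs e) (nbhs e) _ _ (near_chart_img unit_chart_img1)).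
by near=> p; split; near: p.
Unshelve. all: by end_near. Qed.

Lemma diff_chart_mul p :
  [/\ chart_img phi p.1, chart_img phi p.2 &
      chart_dom phi (psi p.1 * psi p.2)%g] ->
  differentiable chart_mul p.
Proof.
move=> Hp; pose i := sval (cid (atlas_cover (lg_atlas G) 1%g)).
by have [+ _] := @lg_mul_smooth _ _ G i i i 1; apply.
Qed.

Lemma diff_diff_chart_mul w p :
  [/\ chart_img phi p.1, chart_img phi p.2 &
      chart_dom phi (psi p.1 * psi p.2)%g] ->
  differentiable (fun q => 'd chart_mul q w) p.
Proof.
move=> Hp; pose i := sval (cid (atlas_cover (lg_atlas G) 1%g)).
by have [_ /(_ w)[+ _]] := @lg_mul_smooth _ _ G i i i 2; apply.
Qed.

Lemma chart_mul_dom_r x : chart_img phi x ->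
  [/\ chart_img phi x, chart_img phi e & chart_dom phi (psi x * psi e)%g].
Proof.
move=> ix; split=> //; first exact: unit_chart_img1.
by rewrite unit_chart_inv1 mulg1; exact: chart_dom_inv.
Qed.

Lemma chart_mul_dom_l x : chart_img phi x ->
  [/\ chart_img phi e, chart_img phi x & chart_dom phi (psi e * psi x)%g].
Proof.
move=> ix; split=> //; first exact: unit_chart_img1.
by rewrite unit_chart_inv1 mul1g; exact: chart_dom_inv.
Qed.

(** Both invariant fields are partial differentials of the same smooth map, and
    thus differentiable at the unit. *)
Lemma left_inv_fieldE x v : chart_img phi x ->
  left_inv_field G v x = 'd chart_mul (x, e) (0, v).
Proof.
move=> ix; have dm := diff_chart_mul (p := (x, e)) (chart_mul_dom_r ix).
have [dp Ep] := is_diff_pairr e x.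
have := diff_comp dp dm => /(congr1 (fun f => f v)) /=.
by rewrite Ep.
Qed.

Lemma right_inv_fieldE x w : chart_img phi x ->
  right_inv_field w x = 'd chart_mul (e, x) (w, 0).
Proof.
move=> ix; have dm := diff_chart_mul (p := (e, x)) (chart_mul_dom_l ix).
have [dp Ep] := is_diff_pairl e x.
have := diff_comp dp dm => /(congr1 (fun f => f w)) /=.
by rewrite Ep.
Qed.

Lemma left_inv_field1 v : left_inv_field G v e = v.
Proof.
have h : \forall y \near e, id y = phi (psi e * psi y)%g.
  have := near_chart_img unit_chart_img1.
  apply: filterS => y iy.
  by rewrite unit_chart_inv1 mul1g chart_invK.
rewrite /left_inv_field -(near_eq_diff h)//.
by rewrite diff_val.
Qed.

Lemma right_inv_field1 v : right_inv_field v e = v.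
Proof.
have h : \forall y \near e, id y = phi (psi y * psi e)%g.
  have := near_chart_img unit_chart_img1.
  apply: filterS => y iy.
  by rewrite unit_chart_inv1 mulg1 chart_invK.
rewrite /right_inv_field -(near_eq_diff h)//.
by rewrite diff_val.
Qed.

Lemma diff_chart_mul1 u v : 'd chart_mul (e, e) (u, v) = u + v.
Proof.
have -> : (u, v) = (u, 0) + (0, v) :> g * g.
  by congr pair; rewrite ?addr0 ?add0r.
rewrite linearD -(right_inv_fieldE _ unit_chart_img1).
by rewrite -(left_inv_fieldE _ unit_chart_img1) left_inv_field1 right_inv_field1.
Qed.

Lemma is_diff_left_inv_field v :
  is_diff e (left_inv_field G v)
    (fun u => 'd (fun p => 'd chart_mul p (0, v)) (e, e) (u, 0)).
Proof.
have dd := diff_diff_chart_mul (0, v) (p := (e, e))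
  (chart_mul_dom_r unit_chart_img1).
have dp := is_diff_pairl e e.
have [dc Ec] := is_diff_comp dp (differentiableP dd).
have h : \forall x \near e,
    ((fun p => 'd chart_mul p (0, v)) \o (fun z => (z, e))) x =
    left_inv_field G v x.
  have := near_chart_img unit_chart_img1.
  by apply: filterS => x /left_inv_fieldE ->.
apply: DiffDef; first exact: near_eq_differentiable h dc.
by rewrite -(near_eq_diff h dc) Ec.
Qed.

Lemma is_diff_right_inv_field w :
  is_diff e (right_inv_field w)
    (fun u => 'd (fun p => 'd chart_mul p (w, 0)) (e, e) (0, u)).
Proof.
have dd := diff_diff_chart_mul (w, 0) (p := (e, e))
  (chart_mul_dom_r unit_chart_img1).
have dp := is_diff_pairr e e.
have [dc Ec] := is_diff_comp dp (differentiableP dd).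
have h : \forall x \near e,
    ((fun p => 'd chart_mul p (w, 0)) \o (fun z => (e, z))) x =
    right_inv_field w x.
  have := near_chart_img unit_chart_img1.
  by apply: filterS => x /right_inv_fieldE ->.
apply: DiffDef; first exact: near_eq_differentiable h dc.
by rewrite -(near_eq_diff h dc) Ec.
Qed.

(** The mixed second derivative of the multiplication does not depend on the
    order of the derivations. *)
Lemma diff_right_left u w :
  'd (right_inv_field w) e u = 'd (left_inv_field G u) e w.
Proof.
have [_ El] := is_diff_left_inv_field u.
have [_ Er] := is_diff_right_inv_field w.
have Hee := chart_mul_dom_r unit_chart_img1.
have nd : \forall p \near (e, e), differentiable chart_mul p.
  by have := near_chart_mul_dom; apply: filterS => p /diff_chart_mul.
have du := diff_diff_chart_mul (0, u) (p := (e, e)) Hee.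
have dw := diff_diff_chart_mul (w, 0) (p := (e, e)) Hee.
have S := schwarz nd dw du.
exact: etrans (congr1 (@^~ u) Er) (etrans S (esym (congr1 (@^~ w) El))).
Qed.

Lemma lie_bracket_unit u v :
  lie_bracket G u v =
  'd (left_inv_field G v) e u - 'd (left_inv_field G u) e v.
Proof.
have E1 : 'd (left_inv_field G v) e (left_inv_field G u e) =
    'd (left_inv_field G v) e u := congr1 _ (left_inv_field1 u).
have E2 : 'd (left_inv_field G u) e (left_inv_field G v e) =
    'd (left_inv_field G u) e v := congr1 _ (left_inv_field1 v).
rewrite /lie_bracket /field_bracket.
by rewrite [X in X - _ = _]E1 [X in _ - X = _]E2.
Qed.

(** As the derivations commute, the second term of the bracket is a derivative
    of the right-invariant field of [v], and the bracket measures how far the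
    left- and right-invariant fields of [v] differ to first order. *)
Lemma lie_bracketE u v :
  lie_bracket G u v = 'd (left_inv_field G v) e u - 'd (right_inv_field v) e u.
Proof. by rewrite lie_bracket_unit -[X in _ - X = _]diff_right_left. Qed.

Lemma lie_bracketC u v : lie_bracket G u v = - lie_bracket G v u.
Proof. by rewrite /lie_bracket /field_bracket opprB. Qed.

Lemma lie_bracketPr u c v w :
  lie_bracket G u (c *: v + w) = c *: lie_bracket G u v + lie_bracket G u w.
Proof.
have [dv _] := is_diff_left_inv_field v.
have [dw _] := is_diff_left_inv_field w.
have lE : left_inv_field G (c *: v + w) =
    c \*: left_inv_field G v + left_inv_field G w.
  by apply/funext => x; exact: linearP.
have dE : 'd (left_inv_field G (c *: v + w)) e u =
    c *: 'd (left_inv_field G v) e u + 'd (left_inv_field G w) e u.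
  have [_ E] := is_diffD (is_diffZ c (differentiableP dv)) (differentiableP dw).
  by rewrite lE; exact: (congr1 (@^~ u) E).
rewrite !lie_bracket_unit [X in X - _ = _]dE [X in _ - X = _]linearP.
have aux (a b p q : g) :
    c *: a + b - (c *: p + q) = c *: (a - p) + (b - q).
  by rewrite scalerBr opprD addrACA.
exact: aux.
Qed.

Lemma lie_bracketPl u c v w :
  lie_bracket G (c *: v + w) u = c *: lie_bracket G v u + lie_bracket G w u.
Proof.
by rewrite lie_bracketC lie_bracketPr opprD -scalerN -!(lie_bracketC _ u).
Qed.

End Bracket.
Arguments right_inv_field {R n} G.

(** * The adjoint action on central vectors *)

Section Adjoint.
Context {R : realType} {n : nat} {G : lieGroup R n}.

Local Notation phi := (unit_chart G).
Local Notation psi := (chart_inv (unit_chart G)).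
Local Notation e := (phi 1%g).
Local Notation g := 'rV[R]_n.

Definition chart_conj (a : G) (x : g) : g := phi (a * psi x * a^-1)%g.

Lemma conj_unit_chart_inv1 (a : G) : (a * psi e * a^-1)%g = 1%g.
Proof. by rewrite unit_chart_inv1 mulg1 mulgV. Qed.

Lemma chart_conj1 a : chart_conj a e = e.
Proof. by rewrite /chart_conj conj_unit_chart_inv1. Qed.

Lemma diff_chart_conj a : differentiable (chart_conj a) e.
Proof.
apply: diff_conj; first exact: unit_chart_img1.
by rewrite conj_unit_chart_inv1; exact: unit_chart_dom1.
Qed.

Lemma near_chart_conj_dom a :
  \forall x \near e, chart_dom phi (a * psi x * a^-1)%g.
Proof.
have c1 : {for e, continuous (fun x => a * psi x)%g}.
  apply: (@continuous_mul2 _ _ _ _ (cst a) psi); first exact: cst_continuous.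
  exact: chart_inv_continuous_at unit_chart_img1.
have c2 : {for e, continuous (fun x => a * psi x * a^-1)%g}.
  apply: (@continuous_mul2 _ _ _ _ (fun x => a * psi x)%g (cst a^-1%g)) => //.
  exact: cst_continuous.
apply: c2; apply: near_chart_dom.
by rewrite conj_unit_chart_inv1; exact: unit_chart_dom1.
Qed.

Lemma AdM (a b : G) v : Ad (a * b)%g v = Ad a (Ad b v).
Proof.
have da : differentiable (chart_conj a) (chart_conj b e).
  by rewrite chart_conj1; exact: diff_chart_conj.
have db := diff_chart_conj b.
have h : \forall x \near e, (chart_conj a \o chart_conj b) x = chart_conj (a * b)%g x.
  have := near_chart_conj_dom b; apply: filterS => x bx.
  by rewrite /= /chart_conj chartK// invgM !mulgA.
have E := near_eq_diff h (differentiable_comp db da).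
have E2 := diff_comp db da; rewrite chart_conj1 in E2.
exact: etrans (esym (congr1 (@^~ v) E)) (congr1 (@^~ v) E2).
Qed.

Lemma Ad1 v : Ad (1%g : G) v = v.
Proof.
have h : \forall x \near e, id x = chart_conj 1%g x.
  have := near_chart_img (unit_chart_img1 (G := G)); apply: filterS => x ix.
  by rewrite /chart_conj mul1g invg1 mulg1 chart_invK.
have [di E2] := is_diff_id e.
have E := near_eq_diff h di.
exact: etrans (esym (congr1 (@^~ v) E)) (congr1 (@^~ v) E2).
Qed.

(** A left translation is a conjugation followed by a right translation. *)
Lemma left_inv_field_Ad x v : chart_img phi x ->
  left_inv_field G v x = right_inv_field G (Ad (psi x) v) x.
Proof.
move=> ix; pose r y := phi (psi y * psi x)%g.
have dr : differentiable r (chart_conj (psi x) e).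
  rewrite chart_conj1; apply: diff_rmul; first exact: unit_chart_img1.
  by rewrite unit_chart_inv1 mul1g; exact: chart_dom_inv.
have dc := diff_chart_conj (psi x).
have h : \forall y \near e,
    (r \o chart_conj (psi x)) y = phi (psi x * psi y)%g.
  have := near_chart_conj_dom (psi x); apply: filterS => y iy.
  by rewrite /= /r /chart_conj chartK// -mulgA mulVg mulg1.
have E := near_eq_diff h (differentiable_comp dc dr).
have E2 := diff_comp dc dr; rewrite chart_conj1 in E2.
exact: etrans (esym (congr1 (@^~ v) E)) (congr1 (@^~ v) E2).
Qed.

(** Near the unit the right-invariant frame is close to the constant frame, so
    that its inverse is bounded. *)
Lemma right_inv_field_lower_bound :
  \forall x \near e, forall w : g, `|w| <= 2 * `|right_inv_field G w x|.
Proof.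
(* Summing [n] coordinates with this error costs at most half of the norm;
   [n.+1] keeps the bound meaningful for [n = 0]. *)
pose c : R := (2 * n.+1%:R)^-1; have c0 : 0 < c by rewrite invr_gt0 mulr_gt0.
have nj : \forall x \near e, forall j : 'I_n,
    `|right_inv_field G (delta_mx 0 j) x - delta_mx 0 j| <= c.
  have nj0 (j : 'I_n) : \forall x \near e,
      `|right_inv_field G (delta_mx 0 j) x - delta_mx 0 j| <= c.
    have [dr _] := is_diff_right_inv_field (G := G) (delta_mx 0 j).
    have /cvgrPdist_le/(_ _ c0) := differentiable_continuous dr.
    rewrite /= right_inv_field1; apply: filterS => x.
    by rewrite distrC.
  exact: filter_forall nj0.
apply: filterS nj => x nj w.
have wE : right_inv_field G w x - w =
    \sum_j w 0 j *: (right_inv_field G (delta_mx 0 j) x - delta_mx 0 j).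
  have -> : right_inv_field G w x = \sum_j w 0 j *: right_inv_field G (delta_mx 0 j) x.
    rewrite {1}(row_sum_delta w); apply: etrans (linear_sum _ _ _ _) _.
    by apply: eq_bigr => j _; exact: linearZ.
  rewrite {2}(row_sum_delta w) -sumrB.
  by apply: eq_bigr => j _; rewrite scalerBr.
have wle : `|right_inv_field G w x - w| <= `|w| / 2.
  rewrite wE; apply: (le_trans (ler_norm_sum _ _ _)).
  have -> : `|w| / 2 = \sum_(j < n.+1) `|w| * c.
    rewrite sumr_const card_ord -[RHS]mulr_natr -mulrA; congr (_ * _).
    by rewrite /c invfM -mulrA mulVf ?mulr1// pnatr_eq0.
  rewrite big_ord_recr/=.
  rewrite -[leLHS]addr0 lerD ?mulr_ge0 ?(ltW c0)// ler_sum// => j _.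
  rewrite normrZ ler_pM// [leRHS]/Num.Def.normr/= mx_normrE.
  exact: (le_bigmax _ (fun k : 'I_1 * 'I_n => `|w k.1 k.2|) (0, j)).
have : `|w| <= `|right_inv_field G w x| + `|w| / 2.
  apply: le_trans (lerD (lexx _) wle).
  by rewrite -{1}(subKr (right_inv_field G w x) w) ler_normB.
move: `|w| `|right_inv_field G _ _| => a b; lra.
Qed.


(** With [D] central, [k x = left_inv_field G D x - right_inv_field G D x]
    vanishes at the unit together with its differential, which is
    [lie_bracket G ^~ D] by [lie_bracketE]; and [k x] is the value at [x] of the
    right-invariant field of [Ad (psi x) D - D], which it therefore controls. *)
Lemma is_diff_Ad_central1 D : (forall u, lie_bracket G u D = 0) ->
  is_diff e (fun x => Ad (psi x) D) 0.
Proof.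
move=> Dc; pose k := left_inv_field G D - right_inv_field G D.
have [dl _] := is_diff_left_inv_field (G := G) D.
have [dr _] := is_diff_right_inv_field (G := G) D.
have [dk Ek] := is_diffB (differentiableP dl) (differentiableP dr).
have k1 : k e = 0 by rewrite /k !fctE left_inv_field1 right_inv_field1 subrr.
have dk0 u : 'd k e u = 0.
  by apply: etrans (Dc u); rewrite lie_bracketE; exact: (congr1 (@^~ u) Ek).
have kE x : chart_img phi x -> k x = right_inv_field G (Ad (psi x) D - D) x.
  move=> ix; rewrite /k !fctE left_inv_field_Ad//.
  exact: (esym (linearB _ _ _)).
apply: (@is_diff_eps _ _ _ _ (\0 : {linear g -> g})) => [|eps eps0].
  exact: cst_continuous.
have eps20 : 0 < eps / 2 by rewrite divr_gt0.
have n1 := diff_eps dk eps20.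
have n2 : \forall h \near (0 : g), chart_img phi (h + e).
  by have := near_chart_img (unit_chart_img1 (G := G)); rewrite (near_shift 0) subr0.
have n3 : \forall h \near (0 : g), forall w : g,
    `|w| <= 2 * `|right_inv_field G w (h + e)|.
  by have := right_inv_field_lower_bound; rewrite (near_shift 0) subr0.
near=> h.
have ih : chart_img phi (h + e) by near: h.
rewrite unit_chart_inv1 Ad1 subr0.
have b : `|Ad (psi (h + e)) D - D| <=
    2 * `|right_inv_field G (Ad (psi (h + e)) D - D) (h + e)|.
  by near: h; apply: filterS n3 => h; exact.
apply: (le_trans b); rewrite -kE//.
have : `|k (h + e) - k e - 'd k e h| <= eps / 2 * `|h| by near: h.
rewrite k1 [X in _ - X]dk0 !subr0; move: `|k _| `|h| => p q.
by move=> H; rewrite -ler_pdivlMl// mulrCA mulrA.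
Unshelve. all: by end_near. Qed.

(** Multiplicativity of [Ad] transports the differential at the unit to any
    other point of the chart. *)
Lemma is_diff_Ad_central D : (forall u, lie_bracket G u D = 0) ->
  forall x, chart_img phi x -> is_diff x (fun x => Ad (psi x) D) 0.
Proof.
move=> Dc x ix; pose F y := Ad (psi y) D.
pose tau z := phi ((psi x)^-1 * psi z)%g.
have d1 : chart_dom phi ((psi x)^-1 * psi x)%g.
  by rewrite mulVg; exact: unit_chart_dom1.
have dtau : differentiable tau x by exact: diff_lmul.
have taux : tau x = e by rewrite /tau mulVg.
have dF : is_diff (tau x) F 0 by rewrite taux; exact: is_diff_Ad_central1.
have dA : is_diff (F (tau x)) (Ad (psi x)) (Ad (psi x)).
  have ca : continuous ('d (chart_conj (psi x)) e).
    exact: diff_continuous (diff_chart_conj (psi x)).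
  apply: DiffDef; first exact: linear_differentiable.
  exact: diff_lin.
have [dc Ec] := is_diff_comp (is_diff_comp (differentiableP dtau) dF) dA.
have h : \forall z \near x, (Ad (psi x) \o (F \o tau)) z = F z.
  have nd : \forall z \near x, chart_dom phi ((psi x)^-1 * psi z)%g.
    have c1 : {for x, continuous (fun z => (psi x)^-1 * psi z)%g}.
      apply: (@continuous_mul2 _ _ _ _ (cst (psi x)^-1%g) psi).
        exact: cst_continuous.
      exact: chart_inv_continuous_at.
    exact: c1 _ (near_chart_dom d1).
  apply: filterS nd => z dz.
  change (Ad (psi x) (Ad (psi (tau z)) D) = Ad (psi z) D).
  rewrite (chartK dz); apply: etrans (esym (AdM _ _ _)) _.
  by rewrite mulgA mulgV mul1g.
apply: DiffDef; first exact: near_eq_differentiable h dc.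
rewrite -(near_eq_diff h dc) Ec; apply/funext => u /=.
exact: linear0.
Qed.

Lemma near_Ad_central D : (forall u, lie_bracket G u D = 0) ->
  \forall a \near (1%g : G), Ad a D = D.
Proof.
move=> Dc.
have /nbhs_ballP[r /= r0 ri] := near_chart_img (unit_chart_img1 (G := G)).
have cF x : ball e r x -> Ad (psi x) D = D.
  move=> ex; have dF y : ball e r y -> is_diff y (fun x => Ad (psi x) D) 0.
    by move=> /ri; exact: is_diff_Ad_central.
  apply: etrans (diff0_ball_cst dF ex) _.
  by rewrite unit_chart_inv1 Ad1.
have cphi := chart_continuous_at (unit_chart_dom1 (G := G)).
have n1 := near_chart_dom (unit_chart_dom1 (G := G)).
have n2 : \forall a \near (1%g : G), ball e r (phi a).
  exact: cphi _ (nbhsx_ballx _ _ r0).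
near=> a; rewrite -[a in Ad a](chartK (c := phi)); last by near: a.
by apply: cF; near: a.
Unshelve. all: by end_near. Qed.

(** [a |-> Ad a D] is locally constant, as [Ad (a * u) D = Ad a (Ad u D)]. *)
Lemma Ad_central D : connected [set: G] -> (forall u, lie_bracket G u D = 0) ->
  forall a : G, Ad a D = D.
Proof.
move=> Gc Dc.
have loc (a : G) : \forall b \near a, Ad b D = Ad a D.
  have c1 : {for a, continuous (fun b => a^-1 * b)%g}.
    exact: continuous_lmul.
  have n1 : \forall b \near (a^-1 * a)%g, Ad b D = D.
    by rewrite mulVg; exact: near_Ad_central.
  have n2 := near_continuous c1 n1.
  
  apply: filterS n2 => b Eb.
  rewrite -[X in _ = Ad a X]Eb.

  apply: etrans (AdM _ _ _).
  by rewrite mulgA mulgV mul1g.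
have E : [set a : G | Ad a D = D] = [set: G].
  apply: Gc.
  - by exists 1%g; exact: Ad1.
  - exists [set a : G | Ad a D = D]; last by rewrite setTI.
    rewrite openE => a /= aD; have := loc a; rewrite aD; exact.
  - exists [set a : G | Ad a D = D]; last by rewrite setTI.
    rewrite -openC openE => a /= aD.
    by have := loc a; apply: filterS => b /= ->.
by move=> a; have : [set: G] a by []; rewrite -E.
Qed.

End Adjoint.

(** * One-parameter subgroups *)

Section OneParameter.
Context {R : realType} {n : nat} {G : lieGroup R n}.

Local Notation phi := (unit_chart G).
Local Notation psi := (chart_inv (unit_chart G)).
Local Notation e := (phi 1%g).
Local Notation g := 'rV[R]_n.

(** The differential of the multiplication at the unit is the addition. *)
Lemma is_diff_phi_mul (a b : R -> G) (u v : R -> g) :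
  a 0 = 1%g -> b 0 = 1%g ->
  {for 0, continuous a} -> {for 0, continuous b} ->
  is_diff (0 : R) (phi \o a) u -> is_diff (0 : R) (phi \o b) v ->
  is_diff (0 : R) (fun t => phi (a t * b t)%g) (u + v).
Proof.
move=> a0 b0 ca cb da db.
have [dp Ep] := is_diff_pair da db.
have dm : differentiable (chart_mul (G := G)) ((phi \o a) 0, (phi \o b) 0).
  rewrite /= a0 b0; exact: (diff_chart_mul (p := (e, e))
    (chart_mul_dom_r (unit_chart_img1 (G := G)))).
have h : \forall t \near (0 : R),
    (chart_mul (G := G) \o (fun t => ((phi \o a) t, (phi \o b) t))) t =
    phi (a t * b t)%g.
  have na := near_continuous ca (near_chart_dom (c := phi) _).
  have nb := near_continuous cb (near_chart_dom (c := phi) _).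
  rewrite a0 in na; rewrite b0 in nb.
  have {}na := na (unit_chart_dom1 (G := G)).
  have {}nb := nb (unit_chart_dom1 (G := G)).
  near=> t; rewrite /= /chart_mul/= !chartK//; first by near: t.
  by near: t.
have dc := differentiable_comp dp dm.
apply: DiffDef; first exact: near_eq_differentiable h dc.
rewrite -(near_eq_diff h dc) (diff_comp dp dm) Ep.
apply/funext => t; rewrite /= a0 b0; exact: diff_chart_mul1.
Unshelve. all: by end_near. Qed.

Lemma is_diff_phi_conj (x : G) (a : R -> G) (u : R -> g) :
  a 0 = 1%g -> {for 0, continuous a} ->
  is_diff (0 : R) (phi \o a) u ->
  is_diff (0 : R) (fun t => phi (x * a t * x^-1)%g) (Ad x \o u).
Proof.
move=> a0 ca [da Ea].
have dm : differentiable (chart_conj x) ((phi \o a) 0).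
  by rewrite /= a0; exact: diff_chart_conj.
have h : \forall t \near (0 : R),
    (chart_conj x \o (phi \o a)) t = phi (x * a t * x^-1)%g.
  have na := near_continuous ca (near_chart_dom (c := phi) _).
  rewrite a0 in na; have {}na := na (unit_chart_dom1 (G := G)).
  by near=> t; rewrite /= /chart_conj chartK//; near: t.
have dc := differentiable_comp da dm.
apply: DiffDef; first exact: near_eq_differentiable h dc.
rewrite -(near_eq_diff h dc) (diff_comp da dm) Ea.
by apply/funext => t; rewrite /= a0.
Unshelve. all: by end_near. Qed.

(** If [Ad x] fixes the velocity [Z] of [gamma], the curve
    [x gamma(t) x^-1 gamma(t)^-1] is constant: it starts with velocity [0], and
    its value at [s + t] is obtained from its value at [t] by translations that
    only depend on [s], so that its velocity is [0] everywhere. *)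
Lemma one_parameter_commute (gamma : R -> G) (Z : g) (x : G) :
  continuous gamma ->
  (forall s t, gamma (s + t) = (gamma s * gamma t)%g) ->
  is_derive (0 : R) (1 : R) (phi \o gamma) Z -> Ad x Z = Z ->
  forall t, (x * gamma t)%g = (gamma t * x)%g.
Proof.
move=> cg gD dg xZ.
have g0 : gamma 0 = 1%g.
  by apply: (mulgI (gamma 0)); rewrite -gD addr0 mulg1.
have gN t : gamma (- t) = (gamma t)^-1%g.
  by apply: (mulgI (gamma t)); rewrite -gD subrr g0 mulgV.
pose gN' t := gamma (- t).
pose gx t := (x * gamma t * x^-1)%g.
pose delta t := (gx t * gN' t)%g.
have cgN : continuous gN'.
  move=> t; apply: continuous_comp; [exact: opp_continuous|exact: cg].
have cgx : continuous gx.
  move=> t; apply: (@continuous_mul2 _ _ _ _ (fun t => x * gamma t)%g (cst x^-1%g)).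
    apply: (@continuous_mul2 _ _ _ _ (cst x) gamma); last exact: cg.
    exact: cst_continuous.
  exact: cst_continuous.
have cdelta : continuous delta by move=> t; exact: (continuous_mul2 (cgx t) (cgN t)).
have gx0 : gx 0 = 1%g by rewrite /gx g0 mulg1 mulgV.
have gN0 : gN' 0 = 1%g by rewrite /gN' oppr0.
have deltaD s t : delta (s + t) = (gx s * delta t * gN' s)%g.
  by rewrite /delta /gx /gN' opprD [- s - t]addrC !gD !mulgA mulgVK.
have delta0 : delta 0 = 1%g by rewrite /delta gx0 gN0 mulg1.
have Lg : is_diff (0 : R) (phi \o gamma) ( *:%R ^~ Z).
  case: dg => dg Eg; have dg' := (derivable1_diffP _ _).1 dg.
  apply: DiffDef; first exact: dg'.
  by rewrite (deriv1E dg) derive1E Eg.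
have LgN : is_diff (0 : R) (phi \o gN') (fun t => - t *: Z).
  have Lo : is_diff (0 : R) (-%R : R -> R) -%R by exact: is_diffN.
  have Lg' : is_diff (- (0 : R)) (phi \o gamma) ( *:%R ^~ Z) by rewrite oppr0.
  exact: (@is_diff_comp _ _ _ _ -%R _ (phi \o gamma) _ _ Lo Lg').
have Lgx := is_diff_phi_conj x g0 (cg 0) Lg.
have [dd0 Ed0] := is_diff_phi_mul gx0 gN0 (cgx 0) (cgN 0) Lgx LgN.
have {}Ed0 : 'd (fun t => phi (delta t)) (0 : R) = 0 :> (R -> g).
  rewrite Ed0; apply/funext => t; rewrite !fctE/=.
  have -> : Ad x (t *: Z) = t *: Ad x Z by exact: linearZ.
  by rewrite xZ scaleNr subrr.
have Ldelta s : chart_dom phi (delta s) -> is_diff s (fun t => phi (delta t)) 0.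
  move=> ds; pose f y := phi (gx s * psi y * gN' s)%g.
  have df : differentiable f (phi (delta 0)).
    rewrite delta0; apply: diff_conj; first exact: unit_chart_img1.
    by rewrite unit_chart_inv1 mulg1 -/(delta s).
  have ss : s - s = 0 by rewrite subrr.
  have Lsub : is_diff s (fun t : R => t - s) (id - 0).
    exact: (is_diffB (is_diff_id s) (is_diff_cst s s)).
  have dd1 : differentiable (fun t => phi (delta t)) ((fun t : R => t - s) s).
    by rewrite /= ss.
  have df1 : differentiable f (((fun t => phi (delta t)) \o (fun t : R => t - s)) s).
    by rewrite /= ss.
  have [dc Ec] := is_diff_comp (is_diff_comp Lsub (differentiableP dd1)) (differentiableP df1).
  have h : \forall t \near s,
      (f \o ((fun t => phi (delta t)) \o (fun t : R => t - s))) t = phi (delta t).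
    have cd : {for s, continuous (fun t : R => delta (t - s))}.
      apply: (@continuous_comp _ _ _ (fun t : R => t - s) delta).
        by have [] := Lsub => /differentiable_continuous.
      exact: cdelta.
    have nd := near_continuous cd (near_chart_dom (c := phi) _).
    rewrite ss delta0 in nd; have {}nd := nd (unit_chart_dom1 (G := G)).
    apply: filterS nd => t dt.
    by rewrite /= /f chartK// -deltaD addrC subrK.
  apply: DiffDef; first exact: near_eq_differentiable h dc.
  rewrite -(near_eq_diff h dc) Ec; apply/funext => u /=.
  rewrite ss (congr1 (@^~ _) Ed0).
  exact: linear0.
have [r r0 dr1] : exists2 r, 0 < r & forall t, ball (0 : R) r t -> delta t = 1%g.
  have nd := near_continuous (cdelta 0) (near_chart_dom (c := phi) _).
  rewrite delta0 in nd; have {nd} := nd (unit_chart_dom1 (G := G)).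
  move=> /nbhs_ballP[r /= r0 rd]; exists r => // t rt.
  have Ld s : ball (0 : R) r s -> is_diff s (fun t => phi (delta t)) 0.
    by move=> /rd; exact: Ldelta.
  have := diff0_ball_cst Ld rt; rewrite delta0 => E.
  by rewrite -(chartK (rd _ rt)) E unit_chart_inv1.
(* From a neighborhood of [0] to all of [R] by taking multiples. *)
have dnat s k : delta s = 1%g -> delta (s *+ k) = 1%g.
  move=> ds; elim: k => [|k IH]; first by rewrite mulr0n.
  by rewrite mulrS deltaD IH mulg1 -/(delta s).
have d1 t : delta t = 1%g.
  pose k := (Num.trunc (`|t| / r)).+1.
  have kt : `|t| / k%:R < r.
    rewrite ltr_pdivrMr// mulrC -ltr_pdivrMr//.
    exact: truncnS_gt.
  rewrite -[t](mulfVK (x := k%:R)) ?pnatr_eq0// mulr_natr.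
  apply: dnat; apply: dr1; rewrite -ball_normE/= sub0r normrN.
  by rewrite normrM normfV [`|k%:R|]normr_nat.
move=> t; have := d1 t; rewrite /delta /gx /gN' gN => E.
apply: (mulIg x^-1%g); rewrite mulgK; apply: (mulIg (gamma t)^-1%g).
by rewrite E mulgV.
Qed.

(** A one-parameter subgroup inside the stabilizer that commutes with all of
    [G] acts trivially on the cosets. *)
Lemma central_lie_subgroup_eq0 (H : set G) (Z : g) :
  connected [set: G] -> effective_on_cosets H ->
  (forall u, lie_bracket G u Z = 0) -> lie_subgroup H Z -> Z = 0.
Proof.
move=> Gc Heff Zc [gamma [cg gD dg gH]].
have g1 t : gamma t = 1%g.
  apply: Heff => x.
  rewrite -(one_parameter_commute cg gD dg (Ad_central Gc Zc x)).
  by rewrite mulgA mulVg mul1g.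
case: dg => _ <-; have -> : phi \o gamma = cst e.
  by apply/funext => t; rewrite /= g1.
exact: derive_cst.
Qed.

End OneParameter.

(** * Forms of low degree as functions of vectors *)

Section Forms.
Context {R : realType} {n : nat}.
Local Notation g := 'rV[R]_n.
Implicit Types (lambda : ('I_1 -> g) -> R) (omega : ('I_2 -> g) -> R).

Definition form2 omega (u v : g) : R := omega (cons_vect u (fun=> v)).

Lemma ord1_fun (X : 'I_1 -> g) : X = fun=> X ord0.
Proof. by apply/funext => i; rewrite ord1. Qed.

Lemma cons_vect_ord0 k (v : g) (X : 'I_k -> g) : cons_vect v X ord0 = v.
Proof. by rewrite /cons_vect unlift_none. Qed.

Lemma cons_vect_lift k (v : g) (X : 'I_k -> g) j :
  cons_vect v X (lift ord0 j) = X j.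
Proof. by rewrite /cons_vect liftK. Qed.

Lemma lift_lift0 k (i : 'I_k.+1) : lift (lift ord0 i) (ord0 : 'I_k.+1) = ord0.
Proof. exact/val_inj. Qed.

Lemma lift_lift k (i : 'I_k.+1) (j : 'I_k) :
  lift (lift ord0 i) (lift ord0 j) = lift ord0 (lift i j).
Proof. by apply/val_inj; rewrite /= /bump /= ltnS !add1n addnS. Qed.

Definition cons_vectE :=
  (cons_vect_ord0, cons_vect_lift, lift_lift0, lift_lift).

Lemma cons_vect0 (v : g) (X : 'I_0 -> g) : cons_vect v X = fun=> v.
Proof. by apply/funext => i; rewrite ord1 /cons_vect unlift_none. Qed.

Lemma cons_vect2 (X : 'I_2 -> g) :
  X = cons_vect (X ord0) (fun=> X (lift ord0 ord0)).
Proof.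
apply/funext => i; rewrite /cons_vect.
by case: unliftP => [j ->|->] //=; rewrite ord1.
Qed.

Lemma form1E lambda X : lambda X = form1 lambda (X ord0).
Proof. by rewrite /form1 -ord1_fun. Qed.

Lemma form2E omega X : omega X = form2 omega (X ord0) (X (lift ord0 ord0)).
Proof. by rewrite /form2 -cons_vect2. Qed.

Lemma form1P lambda : multilinear lambda -> forall c u v,
  form1 lambda (c *: u + v) = c * form1 lambda u + form1 lambda v.
Proof.
move=> ml c u v; have := ml (fun=> 0) ord0 c u v.
have rE w : replace_at (fun=> 0) ord0 w = (fun=> w) :> ('I_1 -> g).
  by apply/funext => i; rewrite (ord1 i).
by rewrite !rE.
Qed.

Lemma replace_at_cons2l (u v w : g) :
  replace_at (cons_vect u (fun=> v)) (ord0 : 'I_2) w = cons_vect w (fun=> v).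
Proof. by rewrite [LHS]cons_vect2 /replace_at /= cons_vectE. Qed.

Lemma replace_at_cons2r (u v w : g) :
  replace_at (cons_vect u (fun=> v)) (lift ord0 ord0 : 'I_2) w =
  cons_vect u (fun=> w).
Proof. by rewrite [LHS]cons_vect2 /replace_at /= cons_vectE. Qed.

Lemma form2Pr omega : multilinear omega -> forall w c u v,
  form2 omega w (c *: u + v) = c * form2 omega w u + form2 omega w v.
Proof.
move=> ml w c u v; have := ml (cons_vect w (fun=> 0)) (lift ord0 ord0) c u v.
by rewrite !replace_at_cons2r.
Qed.

Lemma form2Pl omega : multilinear omega -> forall w c u v,
  form2 omega (c *: u + v) w = c * form2 omega u w + form2 omega v w.
Proof.
move=> ml w c u v; have := ml (cons_vect 0 (fun=> w)) ord0 c u v.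
by rewrite !replace_at_cons2l.
Qed.

Lemma form2vv omega : Defs.alternating omega -> forall u, form2 omega u u = 0.
Proof.
move=> alt u; apply: (alt _ ord0 (lift ord0 ord0)) => //.
by rewrite !cons_vectE.
Qed.

Lemma form2C omega : multilinear omega -> Defs.alternating omega ->
  forall u v, form2 omega u v = - form2 omega v u.
Proof.
move=> ml alt u v; apply/eqP; rewrite -addr_eq0; apply/eqP.
have := form2vv alt (1 *: u + v).
rewrite form2Pr// !form2Pl// !form2vv// !mul1r add0r addr0 addrC.
by [].
Qed.

Lemma wedge1_0 lambda (a : ('I_0 -> g) -> R) X :
  wedge1 lambda a X = form1 lambda (X ord0) * a (fun j => X (lift ord0 j)).
Proof. by rewrite /wedge1 big_ord_recl big_ord0 addr0 expr0 mul1r. Qed.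

Lemma wedge1_1 lambda (a : ('I_1 -> g) -> R) X :
  wedge1 lambda a X = form1 lambda (X ord0) * form1 a (X (lift ord0 ord0))
    - form1 lambda (X (lift ord0 ord0)) * form1 a (X ord0).
Proof.
rewrite /wedge1 !big_ord_recl big_ord0 addr0 expr0 mul1r expr1 mulN1r mulNr.
by rewrite !(form1E a) !cons_vectE.
Qed.

Lemma wedge1_2 lambda omega (u v w : g) :
  wedge1 lambda omega (cons_vect u (cons_vect v (fun=> w))) =
  form1 lambda u * form2 omega v w - form1 lambda v * form2 omega u w
  + form1 lambda w * form2 omega u v.
Proof.
rewrite /wedge1 !big_ord_recl big_ord0 addr0 expr0 mul1r expr1 mulN1r mulNr.
rewrite !(form2E omega) !cons_vectE.
rewrite addrA; congr (_ - _ + _).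
by rewrite /= /bump /= expr2 mulN1r opprK mul1r.
Qed.

End Forms.

Section CEDiff.
Context {R : realType} {n : nat} {G : lieGroup R n}.
Local Notation g := 'rV[R]_n.

Lemma ce_diff1 (a : ('I_1 -> g) -> R) X :
  ce_diff G a X = - form1 a (lie_bracket G (X ord0) (X (lift ord0 ord0))).
Proof.
(* Only the indices matter: any operation could replace the bracket. *)
rewrite /ce_diff; move: (lie_bracket G) => br.
rewrite !big_ord_recl big_ord0 addr0.
rewrite !(big_mkcond (fun j : 'I_1 => _ <= _)%N)/= !big_ord_recl !big_ord0/=.
by rewrite !addr0 expr1 mulN1r cons_vect0.
Qed.

Lemma ce_diff2 (omega : ('I_2 -> g) -> R) (u v w : g) :
  ce_diff G omega (cons_vect u (cons_vect v (fun=> w))) =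
  - form2 omega (lie_bracket G u v) w + form2 omega (lie_bracket G u w) v
  - form2 omega (lie_bracket G v w) u.
Proof.
(* Only the indices matter: any operation could replace the bracket. *)
rewrite /ce_diff; move: (lie_bracket G) => br.
rewrite !big_ord_recl big_ord0 addr0.
rewrite !(big_mkcond (fun j : 'I_2 => _ <= _)%N)/=.
rewrite !big_ord_recl !big_ord0/=.
rewrite !(form2E omega) !cons_vectE.
move: (form2 omega (br u v) w) (form2 omega (br u w) v)
  (form2 omega (br v w) u) => a b c.
rewrite /bump/= !addr0 !add0r.
by ring.
Qed.


End CEDiff.

(** * Contraction with a central vector *)

Section Splitting.
Context {R : realType} {n : nat} {G : lieGroup R n} {H : set G}.
Context {omega : ('I_2 -> 'rV[R]_n) -> R} {lambda : ('I_1 -> 'rV[R]_n) -> R}.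
Context (lcs : homogeneous_lcs H omega lambda).
Local Notation g := 'rV[R]_n.
Local Notation l := (form1 lambda).
Local Notation w := (form2 omega).
Local Notation br := (lie_bracket G).

Lemma lee_form_bracket u v : l (br u v) = 0.
Proof.
have [_ _ _ dl _] := lcs.
have := congr1 (@^~ (cons_vect u (fun=> v))) dl.
rewrite ce_diff1 !cons_vectE => /eqP; rewrite oppr_eq0; exact: eqP.
Qed.

Lemma lee_formP c u v : l (c *: u + v) = c * l u + l v.
Proof. by have [_ _ [ml _ _ _] _ _] := lcs; exact: form1P. Qed.

Lemma lee_formZ c u : l (c *: u) = c * l u.
Proof.
have l0 : l 0 = 0.
  have := lee_formP 1 0 0; rewrite scaler0 addr0 mul1r.
  by move/eqP; rewrite -subr_eq0 opprD addNKr oppr_eq0 => /eqP.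
by have := lee_formP c u 0; rewrite !addr0 l0 addr0.
Qed.

Lemma lcs_formP c u v x : w x (c *: u + v) = c * w x u + w x v.
Proof. by have [[mo _ _ _] _ _ _ _] := lcs; exact: form2Pr. Qed.

Lemma lcs_formC u v : w u v = - w v u.
Proof. by have [[mo al _ _] _ _ _ _] := lcs; exact: form2C. Qed.

Lemma lcs_formr0 u : w u 0 = 0.
Proof.
have := lcs_formP 1 0 0 u; rewrite scaler0 addr0 mul1r.
by move/eqP; rewrite -subr_eq0 opprD addNKr oppr_eq0 => /eqP.
Qed.

Lemma mem_ker_form v : (v \in ker_form lambda) = (l v == 0).
Proof.
pose lM := GRing.isLinear.Build R g R^o *%R (l : g -> R^o) lee_formP.
pose lL : {linear g -> R^o} := HB.pack (l : g -> R^o) lM.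
by rewrite memv_ker -[X in linfun X]/(lL : g -> R^o) lfunE.
Qed.

(** The whole of [g] would otherwise be the kernel of the Lee form, and
    [omega] would be closed. *)
Lemma ker_form_neq_full : ce_diff G omega <> (fun=> 0) ->
  ~ (forall v, l v = 0).
Proof.
move=> dn0 l0; apply: dn0; have [_ _ _ _ ->] := lcs.
apply/funext => X; rewrite /wedge1 big1// => i _.
by rewrite l0 mulr0 mul0r.
Qed.

Context (D : g) (Dcentral : forall u, br u D = 0) (lD : l D != 0).

Lemma lie_bracket_central u : br D u = 0.
Proof. by rewrite lie_bracketC Dcentral oppr0. Qed.

(** Contracting [d omega = lambda /\ omega] with the central vector [D]
    recovers [omega] from the contraction of [omega] with [D]. *)
Lemma lcs_form_central u v :
  l D * w u v = w D (br u v) + l u * w D v - l v * w D u.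
Proof.
have [_ _ _ _ dom] := lcs.
have := congr1 (@^~ (cons_vect D (cons_vect u (fun=> v)))) dom.
rewrite ce_diff2 wedge1_2 !lie_bracket_central (lcs_formC _ D).
rewrite (lcs_formC 0) (lcs_formC 0) !lcs_formr0.
move: (br u v) => b; move: (w D b) (w u v) (w D v) (w D u) => p q r s E.
lra.
Qed.

Context (Gconnected : connected [set: G]).

(** The invariance under [H] of the primitive comes from that of [omega] and of
    [D]. *)
Lemma lcs_trivial_class : trivial_class H lambda omega.
Proof.
have [ro nd rl dl dom] := lcs; have [mo ao io vo] := ro.
split.
  split=> //; apply/funext => X; rewrite /twisted_diff.
  by rewrite (congr1 (@^~ X) dom) subrr.
exists (fun Y => - ((l D)^-1 * w D (Y ord0))).
  split.
  - move=> X i c u v; rewrite (ord1 i) /replace_at/= lcs_formP; ring.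
  - by move=> X i j; rewrite (ord1 i) (ord1 j) eqxx.
  - move=> b Hb X; congr (- (_ * _)) => /=.
    rewrite /form2 -[RHS](io b Hb); congr omega.
    by rewrite [RHS]cons_vect2 /= !cons_vectE (Ad_central Gconnected Dcentral).
  - move=> X i; rewrite (ord1 i) => hX; rewrite /form2.
    rewrite (vo _ (lift ord0 ord0)) ?cons_vectE//.
    by rewrite mulr0 oppr0.
apply/funext => X; rewrite /twisted_diff ce_diff1 wedge1_1 (form2E omega).
have bE u : form1 (fun Y => - ((l D)^-1 * w D (Y ord0))) u =
    - ((l D)^-1 * w D u) by [].
rewrite !bE.
have := lcs_form_central (X ord0) (X (lift ord0 ord0)).
move: (X ord0) (X (lift ord0 ord0)) => u v; move: (br u v) => b.
move: (l D) lD (w D b) (w u v) (w D v) (w D u) (l u) (l v) => c c0 p q r s x y E.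
apply: (mulfI c0); by rewrite E; field.
Qed.

(** The twisted differential of a constant [c] is [- c] times the Lee form. *)
Lemma lcs_cohomology1_vanishes : cohomology_vanishes H lambda 0.
Proof.
move=> a [ra da]; exists (fun=> - (form1 a D / l D)).
  by split=> // X [].
apply/funext => X; rewrite /twisted_diff wedge1_0 (form1E a) sub0r.
have := congr1 (@^~ (cons_vect D (fun=> X ord0))) da.
rewrite /twisted_diff ce_diff1 wedge1_1 !cons_vectE lie_bracket_central.
have -> : form1 a 0 = 0.
  have [ma _ _ _] := ra; have := form1P ma 1 0 0.
  rewrite scaler0 addr0 mul1r => /eqP.
  by rewrite -subr_eq0 opprD addNKr oppr_eq0 => /eqP.
move: (X ord0) => u; move: (l D) lD (l u) (form1 a u) (form1 a D).
move=> c c0 x p q E; apply: (mulfI c0).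
have -> : c * - (x * - (q / c)) = x * q by field.
lra.
Qed.

(** Elements of the kernel of the Lee form and multiples of [D] span [g]. *)
Lemma center_ker_form_central u :
  center_of G (ker_form lambda) u -> forall v, br v u = 0.
Proof.
move=> [_ uc] v; pose c := l v / l D.
have vE : v = c *: D + (v - c *: D) by rewrite addrC subrK.
have kv : v - c *: D \in ker_form lambda.
  rewrite mem_ker_form addrC -scaleNr lee_formP /c mulNr divfK// addNr.
  exact: eqxx.
rewrite vE lie_bracketPl lie_bracket_central scaler0 add0r lie_bracketC.
by rewrite (uc _ kv) oppr0.
Qed.

Context (Heff : effective_on_cosets H).

(** A central [u] in the kernel of both the Lee form and the contraction of
    [omega] with [D] is in the kernel of [omega], hence tangent to [H]. *)
Lemma center_ker_form_eq0 u :
  center_of G (ker_form lambda) u -> w D u = 0 -> u = 0.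
Proof.
move=> uZ wu; have uc := center_ker_form_central uZ.
apply: (central_lie_subgroup_eq0 Gconnected Heff uc).
have [_ nd _ _ _] := lcs; apply: nd => v; rewrite -/(form2 omega u v).
have := lcs_form_central v u; rewrite uc lcs_formr0 wu.
have [uk _] := uZ; move: uk; rewrite mem_ker_form => /eqP ->.
rewrite mulr0 mul0r addr0 subr0 => /eqP; rewrite mulf_eq0 (negPf lD)/= => /eqP.
by move=> wvu; rewrite lcs_formC wvu oppr0.
Qed.

Lemma center_of_lin (U : {vspace g}) c u v :
  center_of G U u -> center_of G U v -> center_of G U (c *: u + v).
Proof.
move=> [uU uc] [vU vc]; split; first by rewrite memvD// memvZ.
by move=> x xU; rewrite lie_bracketPl uc// vc// scaler0 addr0.
Qed.

Lemma center_of0 (U : {vspace g}) : center_of G U 0.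
Proof.
split; first exact: mem0v.
move=> v _; have := lie_bracketPl (G := G) v (-1) 0 0.
by rewrite scaler0 addr0 scaleN1r addNr.
Qed.

(** [omega(D, _)] is injective on the center of the kernel of the Lee form. *)
Lemma center_ker_form_dim : exists Z : {vspace g},
  (forall v, v \in Z <-> center_of G (ker_form lambda) v) /\ (\dim Z <= 1)%N.
Proof.
have [[z [zZ z0]]|noz] :=
    pselect (exists z, center_of G (ker_form lambda) z /\ z <> 0); last first.
  exists 0%VS; rewrite dimv0; split=> // v; rewrite memv0; split=> [/eqP->|vZ].
    exact: center_of0.
  by apply/eqP; apply: contrapT => v0; apply: noz; exists v.
have wz : w D z != 0 by apply/eqP => /(center_ker_form_eq0 zZ).
exists <[z]>%VS; split; last by rewrite dim_vline leq_b1.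
move=> v; split=> [/vlineP[k ->]|vZ].
  have -> : k *: z = k *: z + 0 by rewrite addr0.
  exact: center_of_lin zZ (center_of0 _).
apply/vlineP; exists (w D v / w D z).
apply/subr0_eq/center_ker_form_eq0.
  have -> : v - (w D v / w D z) *: z = - (w D v / w D z) *: z + v.
    by rewrite scaleNr addrC.
  exact: center_of_lin.
by rewrite addrC -scaleNr lcs_formP mulNr divfK// addNr.
Qed.

End Splitting.

(** * Existence of a central vector outside of the kernel of the Lee form *)

Section CentralVector.
Context {R : realType} {n : nat} {G : lieGroup R n} {H : set G}.
Context {omega : ('I_2 -> 'rV[R]_n) -> R} {lambda : ('I_1 -> 'rV[R]_n) -> R}.
Context (lcs : homogeneous_lcs H omega lambda).
Context (dom0 : ce_diff G omega <> (fun=> 0)).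
Local Notation g := 'rV[R]_n.
Local Notation l := (form1 lambda).
Local Notation br := (lie_bracket G).

(** Brackets lie in the kernel of the Lee form, so that the line spanned by
    [D] can only be an ideal if [D] is central. *)
Lemma splittable_central : locally_splittable G lambda ->
  exists D, (forall u, br u D = 0) /\ l D != 0.
Proof.
move=> [D [iD _ DF _]].
have lD : l D != 0.
  apply/eqP => lD; apply: (ker_form_neq_full lcs dom0) => v.
  have Dk : (<[D]> <= ker_form lambda)%VS.
    by rewrite -memvE (mem_ker_form lcs) lD.
  have := memvf v; rewrite -DF (addv_idPr Dk) (mem_ker_form lcs) => /eqP//.
exists D; split=> // u.
have /vlineP[k kE] := iD u D (memv_line D).
have := lee_form_bracket lcs u D; rewrite kE (lee_formZ lcs) => /eqP.
by rewrite mulf_eq0 (negPf lD) orbF => /eqP ->; rewrite scale0r.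
Qed.

(** [S :&: ker lambda] is an ideal of [S] that contains the brackets. *)
Lemma simple_ideal_ker (S : {vspace g}) :
  simple_ideal G S -> (S <= ker_form lambda)%VS.
Proof.
move=> [iS [u [v [uS vS uv0]]] Smin].
have brk x y : br x y \in ker_form lambda.
  by rewrite (mem_ker_form lcs) (lee_form_bracket lcs).
have idJ x y : x \in S -> y \in (S :&: ker_form lambda)%VS ->
    br x y \in (S :&: ker_form lambda)%VS.
  by move=> xS; rewrite !memv_cap => /andP[yS _]; rewrite iS// brk.
have [J0|<-] := Smin _ (capvSl _ _) idJ; last exact: capvSr.
case: uv0; apply/eqP; rewrite -memv0 -J0 memv_cap brk andbT.
exact: iS.
Qed.

(** The simple ideals lie in the kernel of the Lee form, so that some [D] in the
    abelian ideal [A] does not; and the bracket of [D] with a simple ideal lies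
    in the intersection of this ideal with [A]. *)
Lemma reductive_central : reductive G ->
  exists D, (forall u, br u D = 0) /\ l D != 0.
Proof.
move=> [A [k [S [[iA abA] sS AS dAS]]]].
have [[D [DA lD]]|noD] := pselect (exists D, D \in A /\ l D != 0); last first.
  case: (ker_form_neq_full lcs dom0) => v.
  have : (A + \sum_(i < k) S i <= ker_form lambda)%VS.
    rewrite subv_add; apply/andP; split.
      apply/subvP => a aA; rewrite (mem_ker_form lcs); apply/negPn/negP => la.
      by apply: noD; exists a.
    by apply/subv_sumP => i _; exact: simple_ideal_ker.
  by rewrite AS => /subvP/(_ v (memvf v)); rewrite (mem_ker_form lcs) => /eqP.
exists D; split=> // u.
have := memvf u; rewrite -AS => /memv_addP[a aA [s sSum ->]].
have zero_l x : br 0 x = 0.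
  have := lie_bracketPl (G := G) x (-1) 0 0.
  by rewrite scaler0 addr0 scaleN1r addNr.
have sD : br s D = 0.
  have /memv_sumP[t tS ->] := sSum.
  have addl x y : br (x + y) D = br x D + br y D.
    by have := lie_bracketPl (G := G) D 1 x y; rewrite !scale1r.
  rewrite (big_morph (fun x => br x D) (id1 := 0) addl (zero_l D)).
  apply: big1 => i _; apply/eqP; rewrite -memv0.
  have /and3P[_ _ /eqP cap0] : [&& directv A, directv (\sum_(i < k) S i) &
      A :&: \sum_(i < k) S i == 0]%VS by rewrite -directv_addE.
  rewrite -cap0 memv_cap iA//=.
  apply: (subvP (sumv_sup i _ (subvv _))) => //.
  have [iS _ _] := sS i.
  by rewrite lie_bracketC memvN iS// tS.
have := lie_bracketPl (G := G) D 1 a s.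
by rewrite !scale1r sD (abA _ _ aA DA) addr0.
Qed.

End CentralVector.

Theorem proposition3p11 (R : realType) (n : nat) (G : lieGroup R n)
    (H : set G) (omega : ('I_2 -> 'rV[R]_n) -> R)
    (lambda : ('I_1 -> 'rV[R]_n) -> R)
    (Gconnected : connected [set: G])
    (Hclosed : closed_subgroup H)
    (Geffective : effective_on_cosets H)
    (lcs : homogeneous_lcs H omega lambda)
    (domega_neq0 : ce_diff G omega <> (fun=> 0)) :
  let conclusion :=
    [/\ trivial_class H lambda omega,
        cohomology_vanishes H lambda 0 &
        exists Z : {vspace 'rV[R]_n},
          (forall v, v \in Z <-> center_of G (ker_form lambda) v) /\
          (\dim Z <= 1)%N] in
  (locally_splittable G lambda -> conclusion) /\
  (reductive G -> conclusion).
Proof.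
move=> conclusion.
have main : (exists D, (forall u, lie_bracket G u D = 0) /\
    form1 lambda D != 0) -> conclusion.
  move=> [D [Dc lD]]; split.
  - exact: (lcs_trivial_class lcs Dc lD Gconnected).
  - exact: (lcs_cohomology1_vanishes Dc lD).
  - exact: (center_ker_form_dim lcs Dc lD Gconnected Geffective).
split=> [/(splittable_central lcs domega_neq0)|].
  exact: main.
by move=> /(reductive_central lcs domega_neq0); exact: main.
Qed.
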